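(* Simplification preserves definability in classical propositional logic: let $X=X'\cup X''$ be a disjoint union of sets of propositional variables, $\Sigma\subseteq\{0,1\}^X$, and $$\Gamma=(\Sigma\restriction X')\times\{0,1\}^{X''}.$$ If $\Sigma$ is formula definable, then so is $\Gamma$.
   Context: $X$ is the set of all propositional variables of a classical (two-valued) propositional language; models are elements of $\{0,1\}^X$, identified with $\{0,1\}^{X'}\times\{0,1\}^{X''}$. $\Sigma\restriction X'=\{\sigma\restriction X':\sigma\in\Sigma\}$. $\Sigma$ is formula definable if there is a formula $\varphi$ whose set of models is $\Sigma$. *)

(* Defs.v *)
From mathcomp Require Import all_boot.
From mathcomp Require Import boolp classical_sets functions.

Set Implicit Arguments.
Unset Strict Implicit.
Unset Printing Implicit Defensive.

Local Open Scope classical_set_scope.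

Section PropositionalLogic.
Variable X : Type.

(* X is an arbitrary, possibly infinite, set of propositional variables. *)
Inductive formula : Type :=
  | FVar of X
  | FTrue
  | FFalse
  | FNot of formula
  | FAnd of formula & formula
  | FOr of formula & formula
  | FImp of formula & formula.

Definition model : Type := X -> bool.

Fixpoint eval (m : model) (phi : formula) : bool :=
  match phi with
  | FVar x => m x
  | FTrue => true
  | FFalse => false
  | FNot a => ~~ eval m a
  | FAnd a b => eval m a && eval m b
  | FOr a b => eval m a || eval m b
  | FImp a b => eval m a ==> eval m b
  end.

Definition models_of (phi : formula) : set model := [set m | eval m phi].

Definition formula_definable (Sigma : set model) : Prop :=
  exists phi : formula, models_of phi = Sigma.

(* Partial assignments on A : set X are functions on the subtype of elements
   of A, and sigL A m is the restriction of m to A. *)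
Definition restr_models (Sigma : set model) (A : set X) : set (A -> bool) :=
  [set sigL A s | s in Sigma].

Variables X1 X2 : set X.

(* The identification of {0,1}^X with {0,1}^X1 x {0,1}^X2. *)
Definition split_model (m : model) : (X1 -> bool) * (X2 -> bool) :=
  (sigL X1 m, sigL X2 m).

Lemma split_model_bij :
  X1 `|` X2 = [set: X] -> X1 `&` X2 = set0 -> bijective split_model.
Proof.
move=> XU XI.
have X2P x : ~ x \in X1 -> x \in X2.
  move=> nx1; have : (X1 `|` X2) x by rewrite XU.
  by case=> /mem_set.
pose glue (p : (X1 -> bool) * (X2 -> bool)) : model := fun x =>
  match pselect (x \in X1) with
  | left h => p.1 (exist _ x h)
  | right h => p.2 (exist _ x (X2P x h))
  end.
exists glue => [m|[f g]].
  by apply/funext => x; rewrite /glue; case: pselect.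
rewrite /split_model; congr pair; apply/funext => -[x hx] /=;
  rewrite /glue; case: pselect => h //=.
- by congr f; apply: val_inj.
- have : (X1 `&` X2) x by split; apply: set_mem.
  by rewrite XI.
- by congr g; apply: val_inj.
Qed.

(* The set of models identified with the set P of pairs of partial models. *)
Definition as_models (P : set ((X1 -> bool) * (X2 -> bool))) : set model :=
  split_model @^-1` P.

End PropositionalLogic.

Arguments restr_models {X} Sigma A.
Arguments as_models {X X1 X2} P.

(* Main.v *)
Require Import Defs.
From mathcomp Require Import all_boot.
From mathcomp Require Import boolp classical_sets functions.

Local Open Scope classical_set_scope.

(** The set to define consists of the models that agree on [X1] with some model
of [Sigma]; it is thus the projection of [Sigma] along [X2]. If [phi] defines
[Sigma], this projection is expressed by quantifying existentially, in [phi],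
over the values of all variables in [X2]. There may be infinitely many of them,
but the truth value of [phi] depends only on the variables occurring in it
([eval_coincidence]), so it is enough to quantify over finitely many. Existential
quantification over the value of a single variable [x] is itself a propositional
formula, Boole's disjunction of [phi] with [x] set to true and [phi] with [x] set
to false ([eval_forget]); iterating it over a finite list ([eval_forget_seq])
gives the required formula ([definable_projection]).

The variables of a formula are collected in a list, and substitution for one
variable needs a test of equality, so the argument runs over an [eqType]; an
arbitrary type of variables is one classically. *)

Section Forgetting.
Context {X : eqType}.
Implicit Types (phi : formula X) (m s : model X) (x : X) (xs : seq X).

Fixpoint vars phi : seq X :=
  match phi with
  | FVar x => [:: x]
  | FTrue | FFalse => [::]
  | FNot a => vars a
  | FAnd a b | FOr a b | FImp a b => vars a ++ vars b
  end.

Lemma eval_coincidence phi m s :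
  {in vars phi, m =1 s} -> eval m phi = eval s phi.
Proof.
elim: phi => [x|||a IHa|a IHa b IHb|a IHa b IHb|a IHa b IHb] //= ms.
- by apply: ms; rewrite inE.
- by rewrite IHa.
all: by rewrite IHa ?IHb // => y ya; apply: ms; rewrite mem_cat ya ?orbT.
Qed.

Fixpoint subst (f : X -> formula X) phi : formula X :=
  match phi with
  | FVar x => f x
  | FTrue => FTrue X
  | FFalse => FFalse X
  | FNot a => FNot (subst f a)
  | FAnd a b => FAnd (subst f a) (subst f b)
  | FOr a b => FOr (subst f a) (subst f b)
  | FImp a b => FImp (subst f a) (subst f b)
  end.

Lemma eval_subst m f phi :
  eval m (subst f phi) = eval (fun x => eval m (f x)) phi.
Proof. by elim: phi => //= [a ->|a -> b ->|a -> b ->|a -> b ->]. Qed.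

Definition set_var x (c : formula X) : formula X -> formula X :=
  subst (fun y => if y == x then c else FVar y).

Lemma eval_set_var m x c phi :
  eval m (set_var x c phi) =
  eval (fun y => if y == x then eval m c else m y) phi.
Proof. by rewrite eval_subst; congr eval; apply/funext => y; case: ifP. Qed.

Definition forget x phi : formula X :=
  FOr (set_var x (FTrue X) phi) (set_var x (FFalse X) phi).

Lemma eval_forget m x phi :
  eval m (forget x phi) <->
  exists b : bool, eval (fun y => if y == x then b else m y) phi.
Proof.
rewrite /= !eval_set_var; split=> [/orP[h|h]|[[] h]].
- by exists true.
- by exists false.
- by rewrite h.
- by rewrite h orbT.
Qed.

(** Successive witnesses for the single variables of [xs] merge into one model
that is unconstrained on [xs], whatever their order and repetitions; conversely
such a model supplies its own values as witnesses. *)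
Lemma eval_forget_seq m xs phi :
  eval m (foldr forget phi xs) <->
  exists2 s, {in [predC xs], s =1 m} & eval s phi.
Proof.
elim: xs m => [|x xs IH] m.
  split=> [h|[s sm]]; first by exists m.
  by rewrite (_ : s = m) //; apply/funext => y; apply: sm.
rewrite [foldr _ _ _]/=; split=> [/eval_forget[b /IH[s sm sphi]]|[s sm sphi]].
  exists s => // y; rewrite !inE negb_or => /andP[/negbTE yx yxs].
  by rewrite sm ?inE // yx.
apply/eval_forget; exists (s x); apply/IH; exists s => // y.
rewrite inE => yxs; case: eqVneq => [->//|yx].
by apply: sm; rewrite !inE negb_or yx.
Qed.

(** Only the variables that occur in [phi] and lie outside [D] need to be
forgotten: this is where a possibly infinite complement of [D] is reduced to a
finite list. *)
Lemma definable_projection (D : pred X) phi :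
  exists psi, forall m,
    eval m psi <-> exists2 s, {in D, s =1 m} & eval s phi.
Proof.
exists (foldr forget phi [seq x <- vars phi | ~~ D x]) => m.
rewrite eval_forget_seq; split=> -[s sm sphi].
  exists s => // x xD; apply: sm.
  by rewrite !inE mem_filter negb_and negbK [D x]xD.
(* Outside the variables of phi and D, the model s is arbitrary and may differ
   from m; it is reset to m there, without effect on the value of phi. *)
exists (fun x => if x \in [seq x <- vars phi | ~~ D x] then s x else m x).
  by move=> x; rewrite inE => /negbTE /= ->.
rewrite -(eval_coincidence _ s) // => x xphi.
by rewrite mem_filter xphi andbT; case: ifPn => // /negbNE; apply: sm.
Qed.

End Forgetting.

Theorem proposition4p4p1 (X : Type) (X1 X2 : set X)
  (X_union : X1 `|` X2 = [set: X])
  (X_disjoint : X1 `&` X2 = set0)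
  (Sigma : set (model X)) :
  formula_definable Sigma ->
  formula_definable
    (as_models (restr_models Sigma X1 `*` [set: X2 -> bool])).
Proof.
move=> [phi <-].
have [psi psiP] :=
  @definable_projection {classic X} (fun x => x \in X1) phi.
exists psi; apply/seteqP; split=> m /=.
  move=> /psiP[s sm sphi]; split=> //; exists s => //.
  by apply/funext => -[x xX1]; apply: sm.
move=> [[s sphi sm] _]; apply/psiP; exists s => // x xX1.
exact: (congr1 (fun f => f (exist _ x xX1)) sm).
Qed.
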